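(* Let $n\ge 3$. The set of elements $\{e_{i\,i+1},\ e_{i+1\,i},\ h_i \mid 1\le i\le n-2\}\subset \mathcal{R}_n(\mathfrak{h})$ (with scalars extended to the field $\mathbb{L}$ described in the context) generates, under the Lie bracket $[x,y]=xy-yx$, a Lie algebra over $\mathbb{L}$ isomorphic to $\mathfrak{sl}_{n-1}$ (that is, to $\mathfrak{sl}_{n-1}(\mathbb{L})$).
   Context: The oscillator algebra $\mathfrak{h}$ is the real Lie algebra with basis $A_+,A_-,A_0,a$, where $a$ is central and $[A_-,A_+]=a$, $[A_0,A_\pm]=\pm A_\pm$. In $\mathcal{U}(\mathfrak{h})^{\otimes n}$ put, for $X\in\{A_0,A_+,A_-\}$ and $1\le k\le n$, $X_{k}:=1^{\otimes(k-1)}\otimes X\otimes 1^{\otimes(n-k)}$ (written $A_{0,k},A_{\pm,k}$), and $a_k:=1^{\otimes(k-1)}\otimes a\otimes 1^{\otimes(n-k)}$. Let $[m]:=\{1,\dots,m\}$. For nonempty $K\subset[n]$ put $A_{0,K}:=\sum_{k\in K}A_{0,k}$, $A_{\pm,K}:=\sum_{k\in K}A_{\pm,k}$, $a_K:=\sum_{k\in K}a_k$, and $$Q_K:=a_KA_{0,K}-A_{+,K}A_{-,K}.$$ Write $Q_{ij}:=Q_{\{i,j\}}$ and $Q_i:=Q_{\{i\}}$. The oscillator Racah algebra $\mathcal{R}_n(\mathfrak{h})$ is the subalgebra of $\mathcal{U}(\mathfrak{h})^{\otimes n}$ generated by all $Q_K$, $\emptyset\ne K\subset[n]$. The elements $a_1,\dots,a_n$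 are central and algebraically independent, and are treated as scalars. For $1\le k\le n-2$ let $$\lambda_k:=\frac{1}{\sqrt{4\,a_{[k]}\,a_{k+1}\,a_{k+2}\,a_{[k+1]}^2\,a_{[k+2]}}}$$ (for a fixed choice of square root). Let $\mathbb{L}$ be a field extension of $\mathbb{R}(a_1,\dots,a_n)$ containing these square roots. One works in $\mathcal{U}(\mathfrak{h})^{\otimes n}\otimes_{\mathbb{R}[a_1,\dots,a_n]}\mathbb{L}$, and $\mathcal{R}_n(\mathfrak{h})$ is understood as the $\mathbb{L}$-subalgebra generated by the $Q_K$. For $1\le k\le n-2$ define $$e_{k\,k+1}:=\lambda_k\big([Q_{[k+1]},[Q_{[k+1]},Q_{k+1\,k+2}]]+a_{[k+1]}[Q_{[k+1]},Q_{k+1\,k+2}]\big),$$ $$e_{k+1\,k}:=\lambda_k\big([Q_{[k+1]},[Q_{[k+1]},Q_{k+1\,k+2}]]-a_{[k+1]}[Q_{[k+1]},Q_{k+1\,k+2}]\big),$$ $$h_k:=\frac{2Q_{[k+1]}}{a_{[k+1]}}-\frac{Q_{[k+2]}}{a_{[k+2]}}-\frac{Q_{[k]}}{a_{[k]}}-\frac{Q_{k+1}}{a_{k+1}}+\frac{Q_{k+2}}{a_{k+2}}.$$ *)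

(* Defs.v *)
From HB Require Import structures.
From mathcomp Require Import all_boot all_order all_algebra.
From mathcomp Require Import generic_quotient fraction.
From mathcomp Require Import boolp reals.
From mathcomp Require Import ring.
From mathcomp.multinomials Require Import mpoly.

Set Implicit Arguments.
Unset Strict Implicit.
Unset Printing Implicit Defensive.

Import GRing.Theory.
Local Open Scope ring_scope.
Local Open Scope quotient_scope.

(** * Algebras given by generators and relations *)

Inductive term (K X : Type) : Type :=
| TVar of X
| TZero
| TOne
| TAdd of term K X & term K X
| TMul of term K X & term K X
| TScale of K & term K X.

Arguments TVar {K X}.
Arguments TZero {K X}.
Arguments TOne {K X}.

Section Presentation.
Variables (K : comNzRingType) (X : Type).
Local Notation T := (term K X).

(* The K-algebra congruence generated by [rel]. *)
Inductive cong (rel : T -> T -> Prop) : T -> T -> Prop :=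
| cong_rel s t : rel s t -> cong rel s t
| cong_refl t : cong rel t t
| cong_sym s t : cong rel s t -> cong rel t s
| cong_trans s t u : cong rel s t -> cong rel t u -> cong rel s u
| cong_add s s' t t' :
    cong rel s s' -> cong rel t t' -> cong rel (TAdd s t) (TAdd s' t')
| cong_mul s s' t t' :
    cong rel s s' -> cong rel t t' -> cong rel (TMul s t) (TMul s' t')
| cong_scale c t t' : cong rel t t' -> cong rel (TScale c t) (TScale c t')
| cong_addA s t u : cong rel (TAdd s (TAdd t u)) (TAdd (TAdd s t) u)
| cong_addC s t : cong rel (TAdd s t) (TAdd t s)
| cong_add0 t : cong rel (TAdd TZero t) t
| cong_addN t : cong rel (TAdd (TScale (-1) t) t) TZero
| cong_mulA s t u : cong rel (TMul s (TMul t u)) (TMul (TMul s t) u)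
| cong_mul1l t : cong rel (TMul TOne t) t
| cong_mul1r t : cong rel (TMul t TOne) t
| cong_mulDl s t u : cong rel (TMul (TAdd s t) u) (TAdd (TMul s u) (TMul t u))
| cong_mulDr s t u : cong rel (TMul s (TAdd t u)) (TAdd (TMul s t) (TMul s u))
| cong_scaleA c d t : cong rel (TScale c (TScale d t)) (TScale (c * d) t)
| cong_scale1 t : cong rel (TScale 1 t) t
| cong_scaleDr c s t :
    cong rel (TScale c (TAdd s t)) (TAdd (TScale c s) (TScale c t))
| cong_scaleDl c d t :
    cong rel (TScale (c + d) t) (TAdd (TScale c t) (TScale d t))
| cong_scaleAl c s t : cong rel (TScale c (TMul s t)) (TMul (TScale c s) t)
| cong_scaleAr c s t : cong rel (TScale c (TMul s t)) (TMul s (TScale c t)).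

HB.instance Definition _ := gen_eqMixin T.
HB.instance Definition _ := gen_choiceMixin T.

Variable rel : T -> T -> Prop.

Definition congb (s t : T) : bool := `[< cong rel s t >].

Lemma congb_equiv : equiv_class_of congb.
Proof.
split=> [t|s t|s t u].
- by apply/asboolP; exact: cong_refl.
- by apply/asboolP/asboolP; exact: cong_sym.
- by move=> /asboolP st /asboolP tu; apply/asboolP; exact: cong_trans st tu.
Qed.

Canonical congb_equivRel := EquivRelPack congb_equiv.

(* K<X> modulo the two-sided ideal generated by the s - t with [rel s t]. *)
Definition palg := {eq_quot congb_equivRel}.
HB.instance Definition _ := Choice.on palg.
HB.instance Definition _ := EqQuotient.on palg.

Implicit Types x y z : palg.

Definition pclass (t : T) : palg := \pi_palg t.
Definition pvar (x : X) : palg := pclass (TVar x).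

Lemma pclass_eq (s t : T) : (pclass s = pclass t) <-> cong rel s t.
Proof.
split=> [h|h].
- by apply/asboolP; have /eqmodP := h.
- by apply/eqmodP/asboolP.
Qed.

Lemma palg_ind (P : palg -> Prop) : (forall t, P (pclass t)) -> forall x, P x.
Proof. by move=> h x; have := h (repr x); rewrite /pclass reprK. Qed.

Lemma cong_repr (t : T) : cong rel (repr (pclass t)) t.
Proof. by apply/pclass_eq; rewrite /pclass reprK. Qed.

Definition padd x y : palg := pclass (TAdd (repr x) (repr y)).
Definition pmul x y : palg := pclass (TMul (repr x) (repr y)).
Definition pscale (c : K) x : palg := pclass (TScale c (repr x)).
Definition popp x : palg := pscale (-1) x.

Lemma paddE s t : padd (pclass s) (pclass t) = pclass (TAdd s t).
Proof. by apply/pclass_eq; apply: cong_add; exact: cong_repr. Qed.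

Lemma pmulE s t : pmul (pclass s) (pclass t) = pclass (TMul s t).
Proof. by apply/pclass_eq; apply: cong_mul; exact: cong_repr. Qed.

Lemma pscaleE c t : pscale c (pclass t) = pclass (TScale c t).
Proof. by apply/pclass_eq; apply: cong_scale; exact: cong_repr. Qed.

Lemma paddA : associative padd.
Proof.
elim/palg_ind=> s; elim/palg_ind=> t; elim/palg_ind=> u.
by rewrite !paddE; apply/pclass_eq; exact: cong_addA.
Qed.

Lemma paddC : commutative padd.
Proof.
elim/palg_ind=> s; elim/palg_ind=> t.
by rewrite !paddE; apply/pclass_eq; exact: cong_addC.
Qed.

Lemma padd0 : left_id (pclass TZero) padd.
Proof. by elim/palg_ind=> t; rewrite paddE; apply/pclass_eq; exact: cong_add0. Qed.

Lemma paddN : left_inverse (pclass TZero) popp padd.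
Proof.
elim/palg_ind=> t; rewrite /popp pscaleE paddE; apply/pclass_eq.
exact: cong_addN.
Qed.

Lemma pmulA : associative pmul.
Proof.
elim/palg_ind=> s; elim/palg_ind=> t; elim/palg_ind=> u.
by rewrite !pmulE; apply/pclass_eq; exact: cong_mulA.
Qed.

Lemma pmul1l : left_id (pclass TOne) pmul.
Proof. by elim/palg_ind=> t; rewrite pmulE; apply/pclass_eq; exact: cong_mul1l. Qed.

Lemma pmul1r : right_id (pclass TOne) pmul.
Proof. by elim/palg_ind=> t; rewrite pmulE; apply/pclass_eq; exact: cong_mul1r. Qed.

Lemma pmulDl : left_distributive pmul padd.
Proof.
elim/palg_ind=> s; elim/palg_ind=> t; elim/palg_ind=> u.
by rewrite !(pmulE, paddE); apply/pclass_eq; exact: cong_mulDl.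
Qed.

Lemma pmulDr : right_distributive pmul padd.
Proof.
elim/palg_ind=> s; elim/palg_ind=> t; elim/palg_ind=> u.
by rewrite !(pmulE, paddE); apply/pclass_eq; exact: cong_mulDr.
Qed.

HB.instance Definition _ := GRing.isZmodule.Build palg paddA paddC padd0 paddN.
HB.instance Definition _ :=
  GRing.Zmodule_isPzRing.Build palg pmulA pmul1l pmul1r pmulDl pmulDr.

Lemma pscaleA c d x : pscale c (pscale d x) = pscale (c * d) x.
Proof.
by elim/palg_ind: x => t; rewrite !pscaleE; apply/pclass_eq; exact: cong_scaleA.
Qed.

Lemma pscale1 : left_id 1 pscale.
Proof. by elim/palg_ind=> t; rewrite pscaleE; apply/pclass_eq; exact: cong_scale1. Qed.

Lemma pscaleDr : right_distributive pscale +%R.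
Proof.
move=> c; elim/palg_ind=> s; elim/palg_ind=> t.
rewrite -![_ + _]/(padd _ _) !(pscaleE, paddE); apply/pclass_eq.
exact: cong_scaleDr.
Qed.

Lemma pscaleDl x : {morph pscale^~ x : c d / c + d}.
Proof.
elim/palg_ind: x => t c d; rewrite -[RHS]/(padd _ _) !pscaleE paddE.
by apply/pclass_eq; exact: cong_scaleDl.
Qed.

HB.instance Definition _ := GRing.Zmodule_isLmodule.Build K palg
  pscaleA pscale1 pscaleDr pscaleDl.

Lemma pscaleAl (c : K) x y : c *: (x * y) = (c *: x) * y.
Proof.
elim/palg_ind: x => s; elim/palg_ind: y => t.
rewrite -[LHS]/(pscale c (pmul _ _)) -[RHS]/(pmul (pscale c _) _).
by rewrite !(pmulE, pscaleE); apply/pclass_eq; exact: cong_scaleAl.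
Qed.

Lemma pscaleAr (c : K) x y : c *: (x * y) = x * (c *: y).
Proof.
elim/palg_ind: x => s; elim/palg_ind: y => t.
rewrite -[LHS]/(pscale c (pmul _ _)) -[RHS]/(pmul _ (pscale c _)).
by rewrite !(pmulE, pscaleE); apply/pclass_eq; exact: cong_scaleAr.
Qed.

(* MathComp's [algType K] demands 1 != 0, which may fail for a general
   presentation, so [palg] is only declared as a ring and a K-module; the two
   lemmas above provide the remaining algebra axioms. *)

Fixpoint teval (A : pzRingType) (sc : K -> A -> A) (v : X -> A) (t : T) : A :=
  match t with
  | TVar x => v x
  | TZero => 0
  | TOne => 1
  | TAdd s t => teval sc v s + teval sc v t
  | TMul s t => teval sc v s * teval sc v t
  | TScale c t => sc c (teval sc v t)
  end.

Lemma pclassE t : pclass t = @teval palg (@GRing.scale K palg) pvar t.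
Proof.
elim: t => //= [s <- t <-|s <- t <-|c t <-].
- by rewrite -paddE.
- by rewrite -pmulE.
- by rewrite -pscaleE.
Qed.

Lemma pvar_rel s t : rel s t ->
  @teval palg (@GRing.scale K palg) pvar s
  = @teval palg (@GRing.scale K palg) pvar t.
Proof. by move=> st; rewrite -!pclassE; apply/pclass_eq; exact: cong_rel. Qed.

Lemma palg_universal (A : algType K) (v : X -> A) :
  (forall s t, rel s t -> teval *:%R v s = teval *:%R v t) ->
  exists f : palg -> A,
    [/\ forall g : X, f (pvar g) = v g, f 1 = 1,
        forall c x y, f (c *: x + y) = c *: f x + f y,
        forall x y, f (x * y) = f x * f y
      & forall t, f (pclass t) = teval *:%R v t].
Proof.
move=> hv.
have hc s t : cong rel s t -> teval *:%R v s = teval *:%R v t.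
  elim=> {s t} //=.
  - by move=> s t u _ -> _ ->.
  - by move=> s s' t t' _ -> _ ->.
  - by move=> s s' t t' _ -> _ ->.
  - by move=> c t t' _ ->.
  - by move=> s t u; rewrite addrA.
  - by move=> s t; rewrite addrC.
  - by move=> t; rewrite add0r.
  - by move=> t; rewrite scaleN1r addNr.
  - by move=> s t u; rewrite mulrA.
  - by move=> t; rewrite mul1r.
  - by move=> t; rewrite mulr1.
  - by move=> s t u; rewrite mulrDl.
  - by move=> s t u; rewrite mulrDr.
  - by move=> c d t; rewrite scalerA.
  - by move=> t; rewrite scale1r.
  - by move=> c s t; rewrite scalerDr.
  - by move=> c d t; rewrite scalerDl.
  - by move=> c s t; rewrite scalerAl.
  - by move=> c s t; rewrite scalerAr.
pose f (x : palg) := teval *:%R v (repr x).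
have fE t : f (pclass t) = teval *:%R v t by apply: hc; exact: cong_repr.
exists f; split => //.
- by move=> x; rewrite fE.
- exact: (fE TOne).
- move=> c; elim/palg_ind=> s; elim/palg_ind=> t.
  by rewrite -[_ *: _ + _]/(padd (pscale c _) _) pscaleE paddE !fE.
- elim/palg_ind=> s; elim/palg_ind=> t.
  by rewrite -[_ * _]/(pmul _ _) pmulE !fE.
Qed.

Inductive subalg_gen (S : palg -> Prop) : palg -> Prop :=
| subalg_base x : S x -> subalg_gen S x
| subalg_one : subalg_gen S 1
| subalg_lin c x y :
    subalg_gen S x -> subalg_gen S y -> subalg_gen S (c *: x + y)
| subalg_mul x y : subalg_gen S x -> subalg_gen S y -> subalg_gen S (x * y).

End Presentation.

Arguments pvar {K X}.

(** * Universal enveloping algebra of a Lie algebra [(g, br)] *)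

Inductive env_rel (K : comNzRingType) (g : lmodType K) (br : g -> g -> g) :
  term K g -> term K g -> Prop :=
| env_lin c x y :
    env_rel br (TVar (c *: x + y)) (TAdd (TScale c (TVar x)) (TVar y))
| env_br x y :
    env_rel br (TMul (TVar x) (TVar y))
               (TAdd (TMul (TVar y) (TVar x)) (TVar (br x y))).

Definition env (K : comNzRingType) (g : lmodType K) (br : g -> g -> g) :=
  palg (env_rel br).

(** * Tensor power of an algebra *)

Section TensorPower.
Variables (K : comNzRingType) (X : Type) (rel : term K X -> term K X -> Prop).
Variable n : nat.
Local Notation U := (palg rel).

(* [TVar (k, u)] is 1 (x) .. (x) u (x) .. (x) 1 with u in position k.  The n-fold
   tensor power of U is the universal algebra equipped with n pairwise
   commuting algebra morphisms from U. *)
Inductive tpow_rel : term K ('I_n * U) -> term K ('I_n * U) -> Prop :=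
| tpow_lin k c u v : tpow_rel (TVar (k, c *: u + v))
                              (TAdd (TScale c (TVar (k, u))) (TVar (k, v)))
| tpow_one k : tpow_rel (TVar (k, 1)) TOne
| tpow_mul k u v : tpow_rel (TVar (k, u * v)) (TMul (TVar (k, u)) (TVar (k, v)))
| tpow_comm k l u v : k != l -> tpow_rel (TMul (TVar (k, u)) (TVar (l, v)))
                                         (TMul (TVar (l, v)) (TVar (k, u))).

Definition tpow := palg tpow_rel.

Definition tin (k : 'I_n) (u : U) : tpow := pvar tpow_rel (k, u).

End TensorPower.

(** * Extension of scalars from K[z_1, .., z_n] *)

Section Extension.
Variables (K : comNzRingType) (X : Type) (rel : term K X -> term K X -> Prop).
Local Notation B := (palg rel).
Variables (n : nat) (z : 'I_n -> B).
Variables (L : comNzRingType) (phi : {mpoly K[n]} -> L).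

(* For central z_1, .., z_n and a ring morphism phi, this is the L-algebra
   B (x)_{K[z]} L, where [TVar b] is b (x) 1: the universal L-algebra with a ring
   morphism from B that is compatible with the actions of K[z_1, .., z_n].  It
   suffices to impose compatibility for the constants and the z_k. *)
Inductive ext_rel : term L B -> term L B -> Prop :=
| ext_add b c : ext_rel (TVar (b + c)) (TAdd (TVar b) (TVar c))
| ext_one : ext_rel (TVar 1) TOne
| ext_mul b c : ext_rel (TVar (b * c)) (TMul (TVar b) (TVar c))
| ext_const r b : ext_rel (TVar (r *: b)) (TScale (phi r%:MP) (TVar b))
| ext_indet k b : ext_rel (TVar (z k * b)) (TScale (phi 'X_k) (TVar b)).

Definition ext := palg ext_rel.

Definition tens1 (b : B) : ext := pvar ext_rel b.

End Extension.

(** * Lie algebras *)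

Definition lie (A : pzRingType) (x y : A) : A := x * y - y * x.

Inductive lie_gen (K : comNzRingType) (V : lmodType K) (br : V -> V -> V)
    (S : V -> Prop) : V -> Prop :=
| lie_base x : S x -> lie_gen br S x
| lie_zero : lie_gen br S 0
| lie_lin c x y :
    lie_gen br S x -> lie_gen br S y -> lie_gen br S (c *: x + y)
| lie_brkt x y : lie_gen br S x -> lie_gen br S y -> lie_gen br S (br x y).

(* Here G and H are Lie subalgebras of (V, brV) and (W, brW). *)
Definition lie_isomorphic (K : comNzRingType) (V W : lmodType K)
    (brV : V -> V -> V) (brW : W -> W -> W)
    (G : V -> Prop) (H : W -> Prop) : Prop :=
  exists f : V -> W,
    [/\ forall x, G x -> H (f x),
        forall c x y, G x -> G y -> f (c *: x + y) = c *: f x + f y,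
        forall x y, G x -> G y -> f (brV x y) = brW (f x) (f y),
        forall x y, G x -> G y -> f x = f y -> x = y
      & forall y, H y -> exists2 x, G x & f x = y].

Definition sl (K : comNzRingType) (m : nat) : 'M[K]_m -> Prop :=
  fun M => \tr M = 0.

(** * The oscillator algebra *)

Section Oscillator.
Variable R : realType.

(* Coordinates 0, 1, 2, 3 refer to the basis A_+, A_-, A_0, a. *)
Local Notation osc := 'rV[R]_4.

Definition osc_p : osc := delta_mx 0 0.
Definition osc_m : osc := delta_mx 0 1.
Definition osc_0 : osc := delta_mx 0 2.
Definition osc_a : osc := delta_mx 0 3.

Definition osc_br (x y : osc) : osc :=
  (x 0 2 * y 0 0 - x 0 0 * y 0 2) *: osc_p
  - (x 0 2 * y 0 1 - x 0 1 * y 0 2) *: osc_m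
  + (x 0 1 * y 0 0 - x 0 0 * y 0 1) *: osc_a.

Lemma osc_br_linear (c : R) x y z :
  osc_br (c *: x + y) z = c *: osc_br x z + osc_br y z.
Proof. by apply/rowP=> i; rewrite !mxE; ring. Qed.

Lemma osc_brxx x : osc_br x x = 0.
Proof. by apply/rowP=> i; rewrite !mxE; ring. Qed.

Lemma osc_jacobi x y z :
  osc_br x (osc_br y z) + osc_br y (osc_br z x) + osc_br z (osc_br x y) = 0.
Proof. by apply/rowP=> i; rewrite !mxE /=; ring. Qed.

Lemma osc_br_mp : osc_br osc_m osc_p = osc_a.
Proof. by apply/rowP=> i; rewrite !mxE /=; ring. Qed.

Lemma osc_br_0p : osc_br osc_0 osc_p = osc_p.
Proof. by apply/rowP=> i; rewrite !mxE /=; ring. Qed.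

Lemma osc_br_0m : osc_br osc_0 osc_m = - osc_m.
Proof. by apply/rowP=> i; rewrite !mxE /=; ring. Qed.

Lemma osc_br_central x : osc_br osc_a x = 0.
Proof. by apply/rowP=> i; rewrite !mxE /=; ring. Qed.

(** * The oscillator Racah algebra *)

Definition Uosc := env osc_br.

Definition uosc (x : osc) : Uosc := pvar (env_rel osc_br) x.

Variable n : nat.

Definition UoscT := tpow (env_rel osc_br) n.

(* X_k and X_K for X in the oscillator algebra. *)
Definition site (x : osc) (k : 'I_n) : UoscT := tin k (uosc x).
Definition sites (x : osc) (K : {set 'I_n}) : UoscT := \sum_(k in K) site x k.

Definition Qosc (K : {set 'I_n}) : UoscT :=
  sites osc_a K * sites osc_0 K - sites osc_p K * sites osc_m K.

(* L is a field extension of R(a_1, .., a_n) through iota. *)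
Variables (L : fieldType) (iota : {rmorphism {fraction {mpoly R[n]}} -> L}).

Definition polyL (p : {mpoly R[n]}) : L := iota (FracField.tofrac p).

Definition UoscL := ext (site osc_a) polyL.

Definition toL (b : UoscT) : UoscL := tens1 (site osc_a) polyL b.

Definition QL (K : {set 'I_n}) : UoscL := toL (Qosc K).

Definition Racah : UoscL -> Prop :=
  subalg_gen (fun x => exists2 K : {set 'I_n}, K != set0 & x = QL K).

(* Sites are numbered from 1 in the formulas below, so that site k is the
   element of 'I_n of value k - 1. *)
Definition lbl (s : seq nat) : {set 'I_n} := [set i : 'I_n | i.+1 \in s].
Definition upto (m : nat) : {set 'I_n} := [set i : 'I_n | i.+1 <= m]%N.

Definition aL (K : {set 'I_n}) : L := \sum_(k in K) polyL 'X_k.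

Definition radicand (k : nat) : L :=
  4 * aL (upto k) * aL (lbl [:: k.+1]) * aL (lbl [:: k.+2])
    * aL (upto k.+1) ^+ 2 * aL (upto k.+2).

(* In [eup] and [edown], sqr k is the chosen square root of [radicand k]. *)
Definition eup (sqr : nat -> L) (k : nat) : UoscL :=
  let Q := QL (upto k.+1) in
  let Q' := QL (lbl [:: k.+1; k.+2]) in
  (sqr k)^-1 *: (lie Q (lie Q Q') + aL (upto k.+1) *: lie Q Q').

Definition edown (sqr : nat -> L) (k : nat) : UoscL :=
  let Q := QL (upto k.+1) in
  let Q' := QL (lbl [:: k.+1; k.+2]) in
  (sqr k)^-1 *: (lie Q (lie Q Q') - aL (upto k.+1) *: lie Q Q').

Definition hdiag (k : nat) : UoscL :=
  (2 / aL (upto k.+1)) *: QL (upto k.+1)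
  - (aL (upto k.+2))^-1 *: QL (upto k.+2)
  - (aL (upto k))^-1 *: QL (upto k)
  - (aL (lbl [:: k.+1]))^-1 *: QL (lbl [:: k.+1])
  + (aL (lbl [:: k.+2]))^-1 *: QL (lbl [:: k.+2]).

Definition chevalley (sqr : nat -> L) (x : UoscL) : Prop :=
  exists2 i : nat, (1 <= i <= n - 2)%N
    & x = eup sqr i \/ x = edown sqr i \/ x = hdiag i.

End Oscillator.

(* Main.v *)
(* With p_k = A_{+,k}, b_k = A_{-,k} / a_k and q_k = A_{0,k} - p_k b_k one has
   [b_k, p_l] = delta_kl, the q_k commute with everything quadratic, and
   Q_K = a_K sum_{k in K} q_k + sum_{i,j in K} (a_K delta_ij - a_j) p_i b_j.
   The matrices (a_K delta_ij - a_j)_{i,j in K} kill the vector (1, .., 1) and map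
   into the hyperplane sum_i a_i x_i = 0, so they live in gl_{n-1}.  In Jacobi coordinates v_j, w_j (dual bases adapted to the
   flag [1] < [2] < ..) the matrix of Q_[m] is a_[m] times a coordinate projection,
   that of Q_{k,k+1} is a 2 x 2 block of rank one, so [Q_[k+1], Q_{k+1,k+2}] only
   involves two off-diagonal matrix units.  Hence e_{k,k+1}, e_{k+1,k} are nonzero
   multiples of matrix units, in h_k the q's cancel, and M |-> sum M_ij p'_i b'_j
   (with the Jacobi modes p', b') is the isomorphism.  It is injective because
   [b'_i, [f M, p'_j]] = M_ij 1, and 1 <> 0 by the Fock representation on
   polynomials in n variables. *)

Require Import Defs.
From HB Require Import structures.
From mathcomp Require Import all_boot all_order all_algebra.
From mathcomp Require Import fraction boolp reals.
From mathcomp Require Import ring zify.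
From mathcomp.multinomials Require Import mpoly.

Set Implicit Arguments.
Unset Strict Implicit.
Unset Printing Implicit Defensive.

Import GRing.Theory.
Local Open Scope ring_scope.

(** * Bracket identities in rings and in presented algebras *)

Section LieBracket.
Variable A : pzRingType.
Implicit Types x y z : A.

Lemma lieC x y : lie x y = - lie y x.
Proof. by rewrite /lie opprB. Qed.

Lemma lie0r x : lie x 0 = 0.
Proof. by rewrite /lie mulr0 mul0r subrr. Qed.

Lemma lieDr x y z : lie x (y + z) = lie x y + lie x z.
Proof. by rewrite /lie mulrDr mulrDl opprD addrACA. Qed.

Lemma lieNr x y : lie x (- y) = - lie x y.
Proof. by rewrite /lie mulrN mulNr opprD. Qed.

Lemma lieBr x y z : lie x (y - z) = lie x y - lie x z.
Proof. by rewrite lieDr lieNr. Qed.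

Lemma lie_sumr I (r : seq I) (P : pred I) x (F : I -> A) :
  lie x (\sum_(i <- r | P i) F i) = \sum_(i <- r | P i) lie x (F i).
Proof. by apply: (big_morph (lie x)); [exact: lieDr | exact: lie0r]. Qed.

Lemma lieMr x y z : lie x (y * z) = lie x y * z + y * lie x z.
Proof. by rewrite /lie mulrBl mulrBr !mulrA addrA subrK. Qed.

Lemma lieDl x y z : lie (x + y) z = lie x z + lie y z.
Proof. by rewrite lieC lieDr opprD -!(lieC _ z). Qed.

Lemma lieBl x y z : lie (x - y) z = lie x z - lie y z.
Proof. by rewrite lieC lieBr opprB addrC -(lieC x) -lieC. Qed.

Lemma lie_suml I (r : seq I) (P : pred I) (F : I -> A) y :
  lie (\sum_(i <- r | P i) F i) y = \sum_(i <- r | P i) lie (F i) y.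
Proof. by rewrite lieC lie_sumr -sumrN; apply: eq_bigr => i _; rewrite -lieC. Qed.

Lemma lieMl x y z : lie (x * y) z = lie x z * y + x * lie y z.
Proof. by rewrite lieC lieMr opprD -mulNr -mulrN -!lieC. Qed.

End LieBracket.

Section PalgScale.
Variables (K : comNzRingType) (X : Type) (rel : term K X -> term K X -> Prop).
Implicit Types x y : palg rel.

Lemma palg_scaleAl c x y : (c *: x) * y = c *: (x * y).
Proof. by rewrite pscaleAl. Qed.

Lemma palg_scaleAr c x y : x * (c *: y) = c *: (x * y).
Proof. by rewrite pscaleAr. Qed.

Lemma lieZl c x y : lie (c *: x) y = c *: lie x y.
Proof. by rewrite /lie palg_scaleAl palg_scaleAr scalerBr. Qed.

Lemma lieZr c x y : lie x (c *: y) = c *: lie x y.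
Proof. by rewrite /lie palg_scaleAl palg_scaleAr scalerBr. Qed.

End PalgScale.

(** * Actions of presented algebras on modules *)

Section PalgModule.
Variables (K : comNzRingType) (X : Type) (rel : term K X -> term K X -> Prop).
Variables (L : comNzRingType) (sg : {rmorphism K -> L}) (V : lmodType L).
Variable v : X -> V -> V.

(** Generators act by plain maps of [V] and scalars act through [sg]. The real algebras [Uosc] and
    [UoscT] can thus act on a space over [L], and linearity is proved separately. *)
Fixpoint tact (t : term K X) (u : V) : V :=
  match t with
  | TVar x => v x u
  | TZero => 0
  | TOne => u
  | TAdd s t => tact s u + tact t u
  | TMul s t => tact s (tact t u)
  | TScale c t => sg c *: tact t u
  end.

Definition pact (x : palg rel) : V -> V := tact (repr x).

Hypothesis v_lin : forall x, linear (v x).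

Lemma tact_lin t : linear (tact t).
Proof.
elim: t => //= [|s IHs t IHt|s IHs t IHt|d t IHt] c u w.
- by rewrite scaler0 addr0.
- by rewrite IHs IHt scalerDr addrACA.
- by rewrite IHt IHs.
- by rewrite IHt scalerDr !scalerA mulrC.
Qed.

Lemma pact_lin x : linear (pact x).
Proof. exact: tact_lin. Qed.

(** Commutation passes from the generators to all words in them. Applied twice, this makes whole
    copies of [Uosc] at distinct sites commute. *)
Lemma pact_comm (g : V -> V) : linear g ->
  (forall x u, v x (g u) = g (v x u)) ->
  forall x u, pact x (g u) = g (pact x u).
Proof.
move=> g_lin vg x; rewrite /pact; move: (repr x).
have g0 : g 0 = 0 by have := g_lin (-1) 0 0; rewrite !scaleN1r !addNr.
have gD u w : g (u + w) = g u + g w by have := g_lin 1 u w; rewrite !scale1r.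
have gZ c u : g (c *: u) = c *: g u by have := g_lin c u 0; rewrite g0 !addr0.
elim=> //= [s IHs t IHt|s IHs t IHt|c t IHt] u.
- by rewrite IHs IHt gD.
- by rewrite IHt IHs.
- by rewrite IHt gZ.
Qed.

Hypothesis v_rel : forall s t, rel s t -> tact s =1 tact t.

(** Most rules of [cong] reduce to module axioms of [V]. Linearity of the action enters for
    distributivity over a sum in the right factor and for moving a scalar past the left factor. *)
Lemma tact_cong s t : cong rel s t -> tact s =1 tact t.
Proof.
have tD t' u w : tact t' (u + w) = tact t' u + tact t' w.
  by have := tact_lin t' 1 u w; rewrite !scale1r.
have t0 t' : tact t' 0 = 0.
  by have := tact_lin t' (-1) 0 0; rewrite !scaleN1r !addNr.
have tZ t' c u : tact t' (c *: u) = c *: tact t' u.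
  by have := tact_lin t' c u 0; rewrite t0 !addr0.
elim=> {s t} //=.
- by move=> s t _ st u; rewrite st.
- by move=> s t u _ st _ tu w; rewrite st.
- by move=> s s' t t' _ hs _ ht u; rewrite hs ht.
- by move=> s s' t t' _ hs _ ht u; rewrite hs ht.
- by move=> c t t' _ ht u; rewrite ht.
- by move=> s t u w; rewrite addrA.
- by move=> s t u; rewrite addrC.
- by move=> t u; rewrite add0r.
- by move=> t u; rewrite rmorphN1 scaleN1r addNr.
- by move=> s t u w; rewrite tD.
- by move=> c d t u; rewrite scalerA -rmorphM.
- by move=> t u; rewrite rmorph1 scale1r.
- by move=> c s t u; rewrite scalerDr.
- by move=> c d t u; rewrite rmorphD scalerDl.
- by move=> c s t u; rewrite tZ.
Qed.

Lemma pact_class t : pact (pclass rel t) =1 tact t.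
Proof. by apply: tact_cong; exact: cong_repr. Qed.

Lemma pact_var x : pact (pvar rel x) =1 v x.
Proof. exact: pact_class. Qed.

Lemma pact0 u : pact 0 u = 0.
Proof. exact: (pact_class TZero). Qed.

Lemma pact1 u : pact 1 u = u.
Proof. exact: (pact_class TOne). Qed.

Lemma pactD x y u : pact (x + y) u = pact x u + pact y u.
Proof. exact: (pact_class (TAdd (repr x) (repr y))). Qed.

Lemma pactZ c x u : pact (c *: x) u = sg c *: pact x u.
Proof. exact: (pact_class (TScale c (repr x))). Qed.

Lemma pactM x y u : pact (x * y) u = pact x (pact y u).
Proof. exact: (pact_class (TMul (repr x) (repr y))). Qed.

End PalgModule.

(** * Generation of sl_N by adjacent matrix units *)

Section SlGenerated.
Variables (L : comNzRingType) (N : nat) (S : 'M[L]_N -> Prop).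
Hypothesis S0 : S 0.
Hypothesis S_lin : forall c x y, S x -> S y -> S (c *: x + y).
Hypothesis S_lie : forall x y, S x -> S y -> S (lie x y).
Hypothesis S_up : forall i j : 'I_N, j = i.+1 :> nat -> S (delta_mx i j).
Hypothesis S_down : forall i j : 'I_N, i = j.+1 :> nat -> S (delta_mx i j).

Lemma lie_delta (i j k l : 'I_N) :
  lie (delta_mx i j : 'M[L]_N) (delta_mx k l)
  = (j == k)%:R *: delta_mx i l - (l == i)%:R *: delta_mx k j.
Proof. by rewrite /lie -!mulmxE !mul_delta_mx_cond !scaler_nat. Qed.

Lemma sl_generated_sum I (r : seq I) (P : pred I) (F : I -> 'M[L]_N) :
  (forall i, P i -> S (F i)) -> S (\sum_(i <- r | P i) F i).
Proof.
by move=> SF; elim/big_ind: _ => // x y Sx Sy; rewrite -[x]scale1r; apply: S_lin.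
Qed.

(** Induction on the distance of i and j, through the neighbour k = j - 1: [E_ik, E_kj] = E_ij and
    [E_jk, E_ki] = E_ji. *)
Lemma sl_generated_delta (i j : 'I_N) : i != j -> S (delta_mx i j).
Proof.
have chain d : forall i j : 'I_N,
    (j = i + d.+1 :> nat)%N -> S (delta_mx i j) /\ S (delta_mx j i).
  elim: d => [|d IH] {}i {}j ij.
    by rewrite addn1 in ij; split; [apply: S_up | apply: S_down].
  have lt_k : (i + d.+1 < N)%N by rewrite (leq_trans _ (ltn_ord j)) // ij !addnS.
  pose k := Ordinal lt_k.
  have [Sik Ski] := IH i k erefl.
  have jk : j = k.+1 :> nat by rewrite ij addnS.
  have ji : (j == i) = false by apply/eqP => /(congr1 val) /=; rewrite ij addnS -addSn; lia.
  split.
    by have := S_lie Sik (S_up jk); rewrite lie_delta eqxx ji scale1r scale0r subr0.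
  by have := S_lie (S_down jk) Ski; rewrite lie_delta eqxx eq_sym ji scale1r scale0r subr0.
rewrite neq_ltn => /orP[] lt_ij.
  apply: (proj1 (chain (j - i).-1 _ _ _)).
  by rewrite prednK ?subn_gt0 // subnKC // ltnW.
apply: (proj2 (chain (i - j).-1 _ _ _)).
by rewrite prednK ?subn_gt0 // subnKC // ltnW.
Qed.

(** As the trace vanishes, each E_ii on the diagonal may be replaced by E_ii - E_oo for a fixed
    index o, and this is the bracket [E_io, E_oi]. *)
Lemma sl_generated (M : 'M[L]_N) : \tr M = 0 -> S M.
Proof.
case: (posnP N) => [N0|N_gt0] trM.
  by have -> : M = 0 by apply/matrixP => i; have := ltn_ord i; rewrite {2}N0.
pose o := Ordinal N_gt0.
have -> : M = \sum_i \sum_(j | j != i) M i j *: delta_mx i j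
              + \sum_(i | i != o) M i i *: (delta_mx i i - delta_mx o o).
  have -> : \sum_(i | i != o) M i i *: (delta_mx i i - delta_mx o o)
            = \sum_i M i i *: (delta_mx i i - delta_mx o o : 'M[L]_N).
    by rewrite [RHS](bigD1 o) //= subrr scaler0 add0r.
  have -> : \sum_i M i i *: (delta_mx i i - delta_mx o o : 'M[L]_N)
            = \sum_i M i i *: delta_mx i i.
    rewrite (eq_bigr (fun i => M i i *: delta_mx i i - M i i *: delta_mx o o)); last first.
      by move=> i _; rewrite scalerBr.
    by rewrite sumrB -scaler_suml -/(\tr M) trM scale0r subr0.
  rewrite -big_split /= [LHS]matrix_sum_delta; apply: eq_bigr => i _.
  by rewrite (bigD1 i) //= addrC.
rewrite -[X in X + _]scale1r; apply: S_lin.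
  apply: sl_generated_sum => i _; apply: sl_generated_sum => j ji.
  by rewrite -[_ *: _]addr0; apply: S_lin => //; apply: sl_generated_delta; rewrite eq_sym.
apply: sl_generated_sum => i io; rewrite -[_ *: _]addr0; apply: S_lin => //.
have <- : lie (delta_mx i o : 'M[L]_N) (delta_mx o i) = delta_mx i i - delta_mx o o.
  by rewrite lie_delta !eqxx !scale1r.
by apply: S_lie; apply: sl_generated_delta; rewrite // eq_sym.
Qed.

End SlGenerated.

(** * Canonical commutation relations and elements quadratic in the modes *)

Section Oscillators.
Variables (L : comNzRingType) (X : Type) (rel : term L X -> term L X -> Prop).
Local Notation A := (palg rel).

(** The p's create and the b's annihilate. The notion serves both for the site modes and for the
    Jacobi modes. *)
Definition oscillators n (p b : 'I_n -> A) : Prop :=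
  [/\ forall i j, lie (b i) (p j) = (i == j)%:R *: (1 : A),
      forall i j, lie (p i) (p j) = 0
    & forall i j, lie (b i) (b j) = 0].

(** The Jordan-Schwinger map. *)
Definition quad n (p b : 'I_n -> A) (M : 'M[L]_n) : A :=
  \sum_i \sum_j M i j *: (p i * b j).

Lemma quad_lin n (p b : 'I_n -> A) c M M' :
  quad p b (c *: M + M') = c *: quad p b M + quad p b M'.
Proof.
rewrite scaler_sumr -big_split; apply: eq_bigr => i _ /=.
rewrite scaler_sumr -big_split; apply: eq_bigr => j _ /=.
by rewrite !mxE scalerDl scalerA.
Qed.

Lemma quad0 n (p b : 'I_n -> A) : quad p b 0 = 0.
Proof. by have := quad_lin p b (-1) 0 0; rewrite !scaleN1r !addNr. Qed.

Lemma quadZ n (p b : 'I_n -> A) c M : quad p b (c *: M) = c *: quad p b M.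
Proof. by have := quad_lin p b c M 0; rewrite quad0 !addr0. Qed.

Lemma quadD n (p b : 'I_n -> A) M M' : quad p b (M + M') = quad p b M + quad p b M'.
Proof. by have := quad_lin p b 1 M M'; rewrite !scale1r. Qed.

Lemma quadB n (p b : 'I_n -> A) M M' : quad p b (M - M') = quad p b M - quad p b M'.
Proof. by rewrite -scaleN1r quadD quadZ scaleN1r. Qed.

Section LieQuad.
Variables (n : nat) (p b : 'I_n -> A).
Hypothesis osc : oscillators p b.

Lemma lie_quad_p M j : lie (quad p b M) (p j) = \sum_i M i j *: p i.
Proof.
have [bp pp _] := osc.
rewrite lie_suml; apply: eq_bigr => i _; rewrite lie_suml (bigD1 j) //= big1 => [|k kj].
  by rewrite lieZl lieMl pp mul0r add0r bp eqxx scale1r mulr1 addr0.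
by rewrite lieZl lieMl pp bp (negPf kj) scale0r mul0r mulr0 addr0 scaler0.
Qed.

Lemma lie_quad_b M i : lie (quad p b M) (b i) = - \sum_j M i j *: b j.
Proof.
have [bp _ bb] := osc.
rewrite lie_suml (bigD1 i) //= [X in _ + X]big1 => [|k ki].
  rewrite addr0 lie_suml -sumrN; apply: eq_bigr => j _.
  by rewrite lieZl lieMl bb mulr0 addr0 lieC bp eqxx scale1r mulN1r scalerN.
rewrite lie_suml big1 // => j _.
rewrite lieZl lieMl bb mulr0 addr0 lieC bp eq_sym (negPf ki).
by rewrite scale0r oppr0 mul0r scaler0.
Qed.

(** The bracket with [quad p b M] acts on the p's by M and on the b's by minus the transpose of M.
    By the Leibniz rule on p_k b_l, the first action yields M M' and the second - M' M. *)
Lemma lie_quad M M' : lie (quad p b M) (quad p b M') = quad p b (lie M M').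
Proof.
transitivity (\sum_k \sum_l (\sum_i (M' k l * M i k) *: (p i * b l)
                           - \sum_j (M' k l * M l j) *: (p k * b j))).
  rewrite lie_sumr; apply: eq_bigr => k _; rewrite lie_sumr; apply: eq_bigr => l _.
  rewrite lieZr lieMr lie_quad_p lie_quad_b mulrN scalerBr mulr_suml mulr_sumr.
  rewrite !scaler_sumr; congr (_ - _); apply: eq_bigr => i _.
    by rewrite palg_scaleAl scalerA.
  by rewrite palg_scaleAr scalerA.
under eq_bigr do rewrite sumrB.
rewrite sumrB quadB; congr (_ - _).
  under eq_bigr do rewrite exchange_big.
  rewrite exchange_big; apply: eq_bigr => i _; rewrite exchange_big.
  apply: eq_bigr => l _; rewrite mxE scaler_suml; apply: eq_bigr => k _.
  by rewrite mulrC.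
apply: eq_bigr => k _; rewrite exchange_big; apply: eq_bigr => j _ /=.
by rewrite mxE scaler_suml.
Qed.

Lemma quad_coef M i j : lie (b i) (lie (quad p b M) (p j)) = M i j *: (1 : A) :> A.
Proof.
have [bp _ _] := osc.
rewrite lie_quad_p lie_sumr (bigD1 i) //= big1 => [|k ki].
  by rewrite lieZr bp eqxx scale1r addr0.
by rewrite lieZr bp eq_sym (negPf ki) scale0r scaler0.
Qed.

End LieQuad.

Section ModeChange.
Variables (n N : nat) (p b : 'I_n -> A) (V : 'M[L]_(n, N)) (W : 'M[L]_(N, n)).

Definition mode_p (j : 'I_N) : A := \sum_k V k j *: p k.
Definition mode_b (i : 'I_N) : A := \sum_k W i k *: b k.

(** The brackets of the new b's with the new p's are the entries of [W *m V]. The matrices may be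
    rectangular, so that N + 1 sites can give N Jacobi modes. *)
Lemma mode_oscillators :
  oscillators p b -> W *m V = 1%:M -> oscillators mode_p mode_b.
Proof.
move=> [bp pp bb] WV; split=> i j.
- have <- : (W *m V) i j = (i == j)%:R by rewrite WV mxE.
  rewrite lie_suml mxE scaler_suml; apply: eq_bigr => k _.
  rewrite lieZl lie_sumr (bigD1 k) //= big1 => [|l lk].
    by rewrite lieZr bp eqxx scale1r addr0 scalerA.
  by rewrite lieZr bp eq_sym (negPf lk) scale0r scaler0.
- rewrite lie_suml big1 // => k _; rewrite lie_sumr big1 ?scaler0 // => l _.
  by rewrite lieZl lieZr pp !scaler0.
- rewrite lie_suml big1 // => k _; rewrite lie_sumr big1 ?scaler0 // => l _.
  by rewrite lieZl lieZr bb !scaler0.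
Qed.

Lemma quad_mode M : quad mode_p mode_b M = quad p b (V *m M *m W).
Proof.
transitivity (\sum_i \sum_j \sum_k \sum_l (V k i * M i j * W j l) *: (p k * b l)).
  apply: eq_bigr => i _; apply: eq_bigr => j _.
  rewrite mulr_suml scaler_sumr; apply: eq_bigr => k _.
  rewrite mulr_sumr scaler_sumr; apply: eq_bigr => l _.
  by rewrite palg_scaleAl palg_scaleAr !scalerA mulrCA mulrA.
under eq_bigr do rewrite exchange_big.
rewrite exchange_big; apply: eq_bigr => k _ /=.
under eq_bigr do rewrite exchange_big.
rewrite exchange_big; apply: eq_bigr => l _ /=.
rewrite exchange_big mxE scaler_suml; apply: eq_bigr => j _ /=.
by rewrite mxE mulr_suml scaler_suml.
Qed.

End ModeChange.

End Oscillators.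

(** * Fock representation on polynomials *)

(* [fock_osc] lets [A_+, A_-, A_0, a] act at site [k] on polynomials as [X_k],
   [a_k d/dX_k], [X_k d/dX_k] and [a_k]. *)
Section Fock.
Variables (R : realType) (n : nat) (L : fieldType).
Variable iota : {rmorphism {fraction {mpoly R[n]}} -> L}.
Local Notation V := {mpoly L[n]}.

Definition polyL_rmorph : {rmorphism {mpoly R[n]} -> L} :=
  iota \o @FracField.tofrac {mpoly R[n]}.

Definition scalarL : {rmorphism R -> L} := polyL_rmorph \o @mpolyC n R.

Definition fock_osc (k : 'I_n) (x : 'rV[R]_4) (u : V) : V :=
  (scalarL (x 0 0))%:MP * ('X_k * u)
  + (scalarL (x 0 1) * polyL iota 'X_k)%:MP * mderiv k u
  + (scalarL (x 0 2))%:MP * ('X_k * mderiv k u)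
  + (scalarL (x 0 3) * polyL iota 'X_k)%:MP * u.

Lemma fock_osc_lin k x : linear (fock_osc k x).
Proof.
move=> c u w; rewrite /fock_osc -!mul_mpolyC !mderivD !mderiv_mulC.
by ring.
Qed.

Lemma mderiv_mulX (k : 'I_n) (u : V) : mderiv k ('X_k * u) = u + 'X_k * mderiv k u.
Proof.
rewrite mderivM mderivX mnm1E eqxx scale1r.
have -> : (U_(k) - U_(k))%MM = 0%MM by apply/mnmP => i; rewrite mnmBE subnn mnm0E.
by rewrite mpolyX0 mul1r.
Qed.

Lemma mderiv_mulX_neq (k l : 'I_n) (u : V) :
  k != l -> mderiv k ('X_l * u) = 'X_l * mderiv k u.
Proof.
by move=> kl; rewrite mderivM mderivX mnm1E eq_sym (negPf kl) scale0r mul0r add0r.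
Qed.

(** The operators a_k d/dX_k and X_k have commutator a_k, and X_k d/dX_k counts the degree in X_k,
    which is raised by X_k and lowered by d/dX_k. *)
Lemma fock_osc_rel k s t : env_rel (@osc_br R) s t ->
  tact scalarL (fock_osc k) s =1 tact scalarL (fock_osc k) t.
Proof.
case=> [c x y|x y] u /=.
  rewrite /fock_osc -!mul_mpolyC !mxE !rmorphD !rmorphM /= !rmorphD !rmorphM /=.
  by ring.
have br0 : osc_br x y 0 0 = x 0 2 * y 0 0 - x 0 0 * y 0 2 by rewrite !mxE /=; ring.
have br1 : osc_br x y 0 1 = x 0 1 * y 0 2 - x 0 2 * y 0 1 by rewrite !mxE /=; ring.
have br2 : osc_br x y 0 2 = 0 by rewrite !mxE /=; ring.
have br3 : osc_br x y 0 3 = x 0 1 * y 0 0 - x 0 0 * y 0 1 by rewrite !mxE /=; ring.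
have scB (c d c' d' : R) : scalarL (c * d - c' * d')
    = scalarL c * scalarL d - scalarL c' * scalarL d' by rewrite rmorphB !rmorphM.
rewrite /fock_osc !mderivD !mderiv_mulC !mderiv_mulX.
rewrite {}br0 {}br1 {}br2 {}br3 !scB rmorph0.
move: (scalarL _) (scalarL _) (scalarL _) (scalarL _) (scalarL _) (scalarL _)
      (scalarL _) (scalarL _) => x0 x1 x2 x3 y0 y1 y2 y3.
by ring.
Qed.

Lemma fock_osc_a k u : fock_osc k (osc_a R) u = polyL iota 'X_k *: u.
Proof.
have coord i : osc_a R 0 i = (i == 3)%:R by rewrite mxE eqxx.
rewrite /fock_osc !coord /= rmorph0 rmorph1.
by rewrite mul0r mul1r !mpolyC0 !mul0r !add0r mul_mpolyC.
Qed.

Lemma fock_osc_comm k l x y u : k != l ->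
  fock_osc k x (fock_osc l y u) = fock_osc l y (fock_osc k x u).
Proof.
move=> kl; have lk : l != k by rewrite eq_sym.
rewrite /fock_osc !mderivD !mderiv_mulC !(mderiv_mulX_neq _ kl, mderiv_mulX_neq _ lk).
rewrite (mderiv_comm k l); ring.
Qed.

Definition fock_site (ku : 'I_n * Uosc R) : V -> V :=
  pact scalarL (fock_osc ku.1) ku.2.

Lemma fock_site_lin ku : linear (fock_site ku).
Proof. by apply: pact_lin => x; exact: fock_osc_lin. Qed.

Lemma fock_site_rel s t : @tpow_rel _ _ (env_rel (@osc_br R)) n s t ->
  tact scalarL fock_site s =1 tact scalarL fock_site t.
Proof.
have lin k := fock_osc_lin k; have rl k := @fock_osc_rel k.
case=> [k c u v|k|k u v|k l u v kl] w; rewrite /= /fock_site /=.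
- by rewrite (pactD (lin k) (rl k)) (pactZ (lin k) (rl k)).
- exact: (pact1 (lin k) (rl k)).
- exact: (pactM (lin k) (rl k)).
- apply: pact_comm => [|x w']; first exact: pact_lin.
  by apply/esym/pact_comm => // y w''; apply: fock_osc_comm; rewrite eq_sym.
Qed.

Definition fock_tens : UoscT R n -> V -> V := pact scalarL fock_site.

(** Last of three lifts of the action: to the enveloping algebra, to the tensor power, to the
    extension of scalars. The relation [ext_indet] holds because [osc_a] at site k acts as the
    scalar substituted for ['X_k]. *)
Lemma fock_tens_rel s t :
  ext_rel (site (@osc_a R) : 'I_n -> _) (polyL iota) s t ->
  tact (idfun : {rmorphism L -> L}) fock_tens s =1 tact (idfun : {rmorphism L -> L}) fock_tens t.
Proof.
have lin := fock_site_lin; have rl := @fock_site_rel.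
case=> [b c||b c|r b|k b] u; rewrite /= /fock_tens.
- by rewrite pactD.
- by rewrite pact1.
- by rewrite pactM.
- by rewrite pactZ.
- rewrite pactM // pact_var // /fock_site pact_var; [|exact: fock_osc_lin|exact: fock_osc_rel].
  exact: fock_osc_a.
Qed.

(** On the constant polynomial 1 the unit acts as the identity and 0 as zero. An algebra given by
    relations could collapse, so this has to be shown. *)
Lemma UoscL_oner_neq0 : (1 : UoscL iota) != 0.
Proof.
apply/eqP => /(congr1 (fun x => pact (idfun : {rmorphism L -> L}) fock_tens x 1)).
have lin b : linear (fock_tens b) by apply: pact_lin => k; exact: fock_site_lin.
rewrite pact1 // ?pact0 //; try exact: fock_tens_rel.
by apply/eqP; rewrite oner_neq0.
Qed.

End Fock.

(** * The elements Q_K in terms of site modes *)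

Section RacahQuadratic.
Variables (R : realType) (n : nat) (L : fieldType).
Variable iota : {rmorphism {fraction {mpoly R[n]}} -> L}.
Local Notation A := (UoscL iota).
Local Notation a := (fun k : 'I_n => polyL iota 'X_k).

Lemma lie_uosc (x y : 'rV[R]_4) : lie (uosc x) (uosc y) = uosc (osc_br x y).
Proof.
have /= xy := pvar_rel (env_br (@osc_br R) x y).
by rewrite /lie {1}/uosc xy addrC addKr.
Qed.

Lemma site_lin c (x y : 'rV[R]_4) (k : 'I_n) :
  site (c *: x + y) k = c *: site x k + site y k.
Proof.
rewrite /site /tin.
have /= -> : uosc (c *: x + y) = c *: uosc x + uosc y := pvar_rel (env_lin _ c x y).
exact: (pvar_rel (tpow_lin k c (uosc x) (uosc y))).
Qed.

Lemma site0 (k : 'I_n) : site (0 : 'rV[R]_4) k = 0.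
Proof. by have := site_lin (-1) 0 0 k; rewrite !scaleN1r !addNr. Qed.

Lemma lie_site (x y : 'rV[R]_4) (k l : 'I_n) :
  lie (site x k) (site y l) = if k == l then site (osc_br x y) k else 0.
Proof.
rewrite /site /tin; case: eqVneq => [<-|kl]; last first.
  have /= xy := pvar_rel (tpow_comm (uosc x) (uosc y) kl).
  by rewrite /lie xy subrr.
have /= xy := pvar_rel (tpow_mul k (uosc x) (uosc y)).
have /= yx := pvar_rel (tpow_mul k (uosc y) (uosc x)).
rewrite /lie -xy -yx -lie_uosc /lie.
have /= := pvar_rel (tpow_lin k (-1) (uosc y * uosc x) (uosc x * uosc y)).
by rewrite !scaleN1r ![- _ + _]addrC.
Qed.

Lemma toLD (x y : UoscT R n) : toL iota (x + y) = toL iota x + toL iota y.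
Proof. exact: (pvar_rel (ext_add _ _ x y)). Qed.

Lemma toL0 : toL iota 0 = 0.
Proof. by apply: (addrI (toL iota 0)); rewrite -toLD !addr0. Qed.

Lemma toLN (x : UoscT R n) : toL iota (- x) = - toL iota x.
Proof. by apply: (addrI (toL iota x)); rewrite -toLD !subrr toL0. Qed.

Lemma toLM (x y : UoscT R n) : toL iota (x * y) = toL iota x * toL iota y.
Proof. exact: (pvar_rel (ext_mul _ _ x y)). Qed.

Lemma toL1 : toL iota 1 = 1.
Proof. exact: (pvar_rel (ext_one _ _)). Qed.

Lemma toL_sites x (K : {set 'I_n}) :
  toL iota (sites x K) = \sum_(k in K) toL iota (site x k).
Proof. by apply: (big_morph (toL iota)); [exact: toLD | exact: toL0]. Qed.

Definition siteL (x : 'rV[R]_4) (k : 'I_n) : A := toL iota (site x k).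

Lemma siteLN x k : siteL (- x) k = - siteL x k.
Proof.
rewrite /siteL -toLN; congr toL.
by have := site_lin (-1) x 0 k; rewrite site0 !addr0 !scaleN1r.
Qed.

Lemma siteL0 k : siteL 0 k = 0.
Proof. by rewrite /siteL site0 toL0. Qed.

Lemma lie_siteL x y k l :
  lie (siteL x k) (siteL y l) = if k == l then siteL (osc_br x y) k else 0.
Proof.
by rewrite /siteL /lie -!toLM -toLN -toLD -/(lie _ _) lie_site; case: eqP => // _; rewrite toL0.
Qed.

(** Here the central element a_k turns into a scalar, by [ext_indet] at 1. *)
Lemma siteL_a k : siteL (osc_a R) k = a k *: (1 : A).
Proof.
have /= := pvar_rel (ext_indet (site (@osc_a R) : 'I_n -> _) (polyL iota) k 1).
by rewrite mulr1 /siteL /toL /tens1 => ->; congr (_ *: _); exact: toL1.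
Qed.

(** The sum of the ['X_k] over K takes the value #|K| at the point (1, .., 1), hence is a nonzero
    polynomial, and [iota] is injective as a morphism of fields. *)
Lemma aL_neq0 (K : {set 'I_n}) : K != set0 -> aL iota K != 0.
Proof.
move=> K0; rewrite /aL -(rmorph_sum (polyL_rmorph iota)).
rewrite fmorph_eq0 tofrac_eq0; apply/eqP => /(congr1 (meval (fun=> 1))).
rewrite meval0 rmorph_sum /=; under eq_bigr do rewrite mevalXU.
by apply/eqP; rewrite sumr_const Num.Theory.pnatr_eq0 cards_eq0.
Qed.

Lemma natrL_neq0 m : (m.+1)%:R != 0 :> L.
Proof. by rewrite -(rmorph_nat (scalarL iota)) fmorph_eq0 Num.Theory.pnatr_eq0. Qed.

Lemma a_neq0 k : a k != 0.
Proof.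
have := @aL_neq0 [set k]; rewrite /aL big_set1; apply.
by apply/set0Pn; exists k; rewrite inE.
Qed.

Definition site_p (k : 'I_n) : A := siteL (osc_p R) k.
Definition site_b (k : 'I_n) : A := (a k)^-1 *: siteL (osc_m R) k.
(** The Casimir element Q_k of site k, divided by a_k. *)
Definition site_q (k : 'I_n) : A := siteL (osc_0 R) k - site_p k * site_b k.

Lemma site_oscillators : oscillators site_p site_b.
Proof.
split=> i j.
- rewrite lieZl lie_siteL osc_br_mp; case: eqP => _; rewrite ?scaler0 ?scale0r //.
  by rewrite siteL_a scalerA mulVf ?a_neq0.
- by rewrite lie_siteL osc_brxx siteL0 if_same.
- by rewrite lieZl lieZr lie_siteL osc_brxx siteL0 if_same !scaler0.
Qed.

Lemma lie_q_p k l : lie (site_q k) (site_p l) = 0.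
Proof.
have [bp pp _] := site_oscillators.
rewrite lieBl lieMl pp mul0r add0r bp lie_siteL osc_br_0p.
by case: eqP => _; rewrite ?scale0r ?mulr0 ?subr0 // scale1r mulr1 subrr.
Qed.

Lemma lie_q_b k l : lie (site_q k) (site_b l) = 0.
Proof.
have [bp _ bb] := site_oscillators.
rewrite lieBl lieMl bb mulr0 addr0 (lieC (site_p _)) bp eq_sym.
rewrite lieZr lie_siteL osc_br_0m siteLN.
case: eqP => [->|_]; last by rewrite scaler0 scale0r oppr0 mul0r subr0.
by rewrite scale1r mulN1r opprK scalerN addNr.
Qed.

Lemma lie_q_quad k M : lie (site_q k) (quad site_p site_b M) = 0.
Proof.
rewrite lie_sumr big1 // => i _; rewrite lie_sumr big1 // => j _.
by rewrite lieZr lieMr lie_q_p lie_q_b mul0r mulr0 addr0 scaler0.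
Qed.

(** Since q_k commutes with p_l and b_l, only its bracket with A_{0,l} is left. There p_k b_k
    contributes nothing, as the weights 1 and -1 of its factors cancel. *)
Lemma lie_q_q k l : lie (site_q k) (site_q l) = 0.
Proof.
rewrite {2}/site_q lieBr lieMr lie_q_p lie_q_b mul0r mulr0 addr0 subr0.
rewrite lieC {1}/site_q lieBr lieMr lie_siteL osc_brxx siteL0 if_same sub0r opprK.
rewrite lie_siteL osc_br_0p lieZr lie_siteL osc_br_0m.
case: eqP => [<-|_]; last by rewrite scaler0 mul0r mulr0 addr0.
by rewrite siteLN scalerN mulrN subrr.
Qed.

Definition Qmx (K : {set 'I_n}) : 'M[L]_n :=
  \matrix_(i, j) (((i \in K) && (j \in K))%:R * (aL iota K * (i == j)%:R - a j)).

(** Substitute A_{0,k} = q_k + p_k b_k and A_{-,j} = a_j b_j. The first gives the diagonal a_K, the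
    second the entries - a_j. *)
Lemma QL_quad K :
  QL iota K = aL iota K *: (\sum_(k in K) site_q k) + quad site_p site_b (Qmx K).
Proof.
have -> : QL iota K = aL iota K *: (\sum_(k in K) siteL (osc_0 R) k)
    - \sum_(i in K) \sum_(j in K) a j *: (site_p i * site_b j).
  rewrite /QL toLD toLN !toLM !toL_sites; congr (_ - _).
    rewrite (eq_bigr (fun k => a k *: (1 : A))) => [|k _]; last exact: siteL_a.
    by rewrite -scaler_suml palg_scaleAl mul1r.
  rewrite mulr_suml; apply: eq_bigr => i _; rewrite mulr_sumr; apply: eq_bigr => j _.
  by rewrite /site_b palg_scaleAr scalerA mulfV ?a_neq0 ?scale1r.
rewrite sumrB scalerBr -addrA; congr (_ + _).
have -> : quad site_p site_b (Qmx K) = \sum_(i in K) \sum_(j in K)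
    (aL iota K * (i == j)%:R - a j) *: (site_p i * site_b j).
  rewrite [RHS]big_mkcond; apply: eq_bigr => i _.
  case: ifP => iK; last by rewrite big1 // => j _; rewrite mxE iK mul0r scale0r.
  rewrite [RHS]big_mkcond; apply: eq_bigr => j _; rewrite mxE iK /=.
  by case: (j \in K); rewrite ?mul1r // mul0r scale0r.
rewrite -sumrN scaler_sumr -sumrN -big_split /=; apply: eq_bigr => i iK.
under [in RHS]eq_bigr do rewrite scalerBl.
rewrite sumrB addrA; have -> : \sum_(j in K) (aL iota K * (i == j)%:R)
    *: (site_p i * site_b j) = aL iota K *: (site_p i * site_b i).
  rewrite (bigD1 i) //= eqxx mulr1 big1 => [|j /andP[_ ji]]; first by rewrite addr0.
  by rewrite eq_sym (negPf ji) mulr0 scale0r.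
by rewrite addNr sub0r.
Qed.

Lemma lie_QL_quad K M :
  lie (QL iota K) (quad site_p site_b M) = quad site_p site_b (lie (Qmx K) M).
Proof.
rewrite QL_quad lieDl lieZl lie_suml big1 ?scaler0 ?add0r => [|k _].
  exact: (lie_quad site_oscillators).
exact: lie_q_quad.
Qed.

Lemma lie_QL K K' :
  lie (QL iota K) (QL iota K') = quad site_p site_b (lie (Qmx K) (Qmx K')).
Proof.
rewrite [X in lie _ X]QL_quad lieDr lie_QL_quad lieZr lie_sumr big1 => [|k _].
  by rewrite scaler0 add0r.
rewrite lieC QL_quad lieDr lie_q_quad lieZr lie_sumr big1 => [|l _]; last exact: lie_q_q.
by rewrite scaler0 addr0 oppr0.
Qed.

End RacahQuadratic.

(** * Jacobi coordinates *)

Section JacobiModes.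
Variables (L : fieldType) (a : nat -> L) (N : nat).

Definition psum m : L := \sum_(k < m) a k.

Hypothesis a_neq0 : forall k, (k <= N)%N -> a k != 0.
Hypothesis psum_neq0 : forall m, (m <= N)%N -> psum m.+1 != 0.

(* Sites are numbered from 0.  [jac_v j] spans the sites 0, .., j + 1 and is
   annihilated both by the covector [a] and by [jac_w i] for [i <> j]; it satisfies
   [P_(j+2) - P_(j+1) = jac_v j * jac_w j], where [P_m = (delta_pq - a_q / psum m)]
   is the normalized matrix of [Q] on the first [m] sites. *)
Definition jac_v (j p : nat) : L :=
  (p <= j)%:R - psum j.+1 / a j.+1 * (p == j.+1)%:R.

Definition jac_w (j p : nat) : L :=
  a j.+1 / psum j.+2 * (a p / psum j.+1 * (p <= j)%:R - (p == j.+1)%:R).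

Lemma psumS m : psum m.+1 = psum m + a m.
Proof. exact: big_ord_recr. Qed.

(** The partial sum is proportional to [psum m] up to m = i + 1. The entry at p = i + 1 then cancels
    it, and all later entries vanish. *)
Lemma sum_jac_w i m : (i < N)%N ->
  \sum_(p < m) jac_w i p
  = if (m <= i.+1)%N then a i.+1 / psum i.+2 * (psum m / psum i.+1) else 0.
Proof.
move=> iN; have s1 := psum_neq0 (ltnW iN).
elim: m => [|m IH]; first by rewrite big_ord0 /psum big_ord0 mul0r mulr0.
rewrite big_ord_recr /= IH /jac_w ltnS (psumS m).
case: (ltngtP m i.+1) => [lt|gt|->].
- by rewrite -ltnS lt subr0 mulr1 -mulrDr mulrDl.
- by rewrite leqNgt (ltnW gt) mulr0 subr0 mulr0 addr0.
- by rewrite ltnn divff // mulr0 sub0r mulrN !mulr1 subrr.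
Qed.

(** As [jac_v j] is the indicator of p <= j with one correction at j + 1, the pairing is a partial
    sum of [jac_w i] minus a single term. *)
Lemma jac_dual (i j : nat) : (i < N)%N -> (j < N)%N ->
  \sum_(p < N.+1) jac_w i p * jac_v j p = (i == j)%:R.
Proof.
move=> iN jN.
have s1 := psum_neq0 (ltnW iN); have s2 := psum_neq0 iN; have aj := a_neq0 jN.
transitivity (\sum_(p < j.+1) jac_w i p - psum j.+1 / a j.+1 * jac_w i j.+1).
  under eq_bigr do rewrite mulrBr.
  rewrite sumrB; congr (_ - _).
    rewrite [RHS](big_ord_widen N.+1 (jac_w i) (leqW jN)) [RHS]big_mkcond /=.
    by apply: eq_bigr => p _; rewrite ltnS; case: leqP; rewrite ?mulr1 ?mulr0.
  rewrite (bigD1 (Ordinal (jN : (j.+1 < N.+1)%N))) //= eqxx mulr1 big1 ?addr0 1?mulrC //.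
  by move=> p; rewrite -val_eqE /= => /negPf ->; rewrite !mulr0.
rewrite sum_jac_w // /jac_w ltnS eqSS.
case: (ltngtP i j) => [lt|gt|ij].
- by rewrite mulr0 subr0 !mulr0 subrr.
- by rewrite /= mulr0n mulr1n; field; rewrite s1 s2 aj.
- rewrite -ij in aj *; rewrite /= mulr0n mulr1n mulr0 sub0r (psumS i.+1).
  by field; rewrite s1 -psumS s2 aj.
Qed.

(** The increments P_(i+2) - P_(i+1) telescope, starting from the 1 x 1 matrix P_1 = 1 - a_0 / psum
    1 = 0. *)
Lemma jac_resolution (m p q : nat) : (m <= N)%N ->
  ((p < m.+1) && (q < m.+1))%N%:R * ((p == q)%:R - a q / psum m.+1)
  = \sum_(i < m) jac_v i p * jac_w i q.
Proof.
elim: m => [|m IH] mN.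
  rewrite big_ord0 !ltnS !leqn0; case: eqP => [->|_]; last by rewrite mul0r.
  case: eqP => [->|_]; last by rewrite mul0r.
  by rewrite eqxx psumS /psum big_ord0 add0r divff ?a_neq0 // subrr mulr0.
rewrite big_ord_recr /= -IH ?(ltnW mN) // /jac_v /jac_w.
rewrite (ltnS p m.+1) (ltnS q m.+1) -[(p <= m)%N]ltnS -[(q <= m)%N]ltnS.
have s1 := psum_neq0 (ltnW mN); have s2 := psum_neq0 mN; have am := a_neq0 mN.
move: s2; rewrite (psumS m.+1) => s2.
case: (ltngtP p m.+1) => [ltp|gtp|->]; case: (ltngtP q m.+1) => [ltq|gtq|->] /=;
  rewrite ?ltnn ?eqxx /= ?mulr0n ?mulr1n.
all: try rewrite (ltn_eqF ltp) mulr0n.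
all: by field; rewrite ?s1 ?s2 ?am.
Qed.

(** On the sites j + 1, j + 2 the block is the column (a_(j+2), - a_(j+1)) times the row (1, -1).
    The column is a_(j+1) a_(j+2) / psum (j+2) times v_(j+1) - v_j, and the row is the last
    factor. *)
Lemma jac_adjacent (j p q : nat) : (j.+2 <= N)%N ->
  ((p \in [:: j.+1; j.+2]) && (q \in [:: j.+1; j.+2]))%:R
    * ((a j.+1 + a j.+2) * (p == q)%:R - a q)
  = a j.+1 * a j.+2 / psum j.+2 * (jac_v j.+1 p - jac_v j p)
    * (psum j.+3 / a j.+2 * jac_w j.+1 q - psum j.+1 / a j.+1 * jac_w j q).
Proof.
move=> jN.
have s1 : psum j.+1 != 0 by apply: psum_neq0; lia.
have s2 : psum j.+2 != 0 by apply: psum_neq0; lia.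
have s3 : psum j.+3 != 0 by apply: psum_neq0.
have a1 : a j.+1 != 0 by apply: a_neq0; lia.
have a2 : a j.+2 != 0 by apply: a_neq0.
have inE2 r : (r \in [:: j.+1; j.+2]) = (r == j.+1) || (r == j.+2) by rewrite !inE.
(* An index lies in 0..j, is j + 1, is j + 2, or lies beyond; the two functions are rational
   expressions on each of the resulting 16 cells. *)
have cmp r : [\/
    [/\ (r <= j)%N = true, (r <= j.+1)%N = true, (r == j.+1) = false & (r == j.+2) = false],
    r = j.+1, r = j.+2 |
    [/\ (r <= j)%N = false, (r <= j.+1)%N = false, (r == j.+1) = false & (r == j.+2) = false]].
  have [rj|/eqP] := boolP (r == j.+1); first by constructor 2; apply/eqP.
  have [rj|/eqP] := boolP (r == j.+2); first by constructor 3; apply/eqP.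
  move=> r2 r1; case: (leqP r j) => rj; [constructor 1|constructor 4]; split; lia.
have e1 : (j.+1 <= j)%N = false by lia.
have e2 : (j.+2 <= j)%N = false by lia.
have e3 : (j.+2 <= j.+1)%N = false by lia.
have e4 : (j.+1 == j.+2) = false by lia.
have e5 : (j.+2 == j.+1) = false by lia.
move: s2 s3; rewrite /jac_v /jac_w !inE2 (psumS j.+2) (psumS j.+1) => s2 s3.
case: (cmp p) => [[p1 p2 p3 p4]|->|->|[p1 p2 p3 p4]]; rewrite ?p1 ?p2 ?p3 ?p4;
  case: (cmp q) => [[q1 q2 q3 q4]|->|->|[q1 q2 q3 q4]]; rewrite ?q1 ?q2 ?q3 ?q4;
  rewrite ?eqxx ?leqnn ?e1 ?e2 ?e3 ?e4 ?e5 /= ?mulr0n ?mulr1n;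
  field; rewrite ?s1 ?s2 ?s3 ?a1 ?a2 //.
Qed.

End JacobiModes.

(** * Matrices of the generators in Jacobi modes *)

Section RacahChevalley.
Variables (R : realType) (N : nat) (L : fieldType).
Variable iota : {rmorphism {fraction {mpoly R[N.+1]}} -> L}.
Local Notation A := (UoscL iota).
Local Notation upto := (upto N.+1).
Local Notation lbl := (lbl N.+1).

(* For [k > N] this is the junk value at [inord k = ord0]. *)
Definition wt (k : nat) : L := polyL iota 'X_(inord k).
Local Notation s := (psum wt).

Lemma sum_upto (V : zmodType) (F : nat -> V) m : (m <= N.+1)%N ->
  \sum_(k in upto m) F (k : 'I_N.+1) = \sum_(k < m) F k.
Proof.
move=> mN; rewrite (big_ord_widen N.+1 F mN).
by apply: eq_bigl => k; rewrite inE.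
Qed.

Lemma aL_upto m : (m <= N.+1)%N -> aL iota (upto m) = s m.
Proof.
move=> mN; rewrite /psum -(sum_upto wt mN) /aL.
by apply: eq_bigr => k _; rewrite /wt inord_val.
Qed.

Lemma lbl1 k : (k <= N)%N -> lbl [:: k.+1] = [set inord k].
Proof.
move=> kN; apply/setP => i; rewrite !inE eqSS.
by rewrite -val_eqE /= inordK.
Qed.

Lemma lbl2 k : (k < N)%N -> lbl [:: k.+1; k.+2] = [set inord k; inord k.+1].
Proof.
move=> kN; apply/setP => i; rewrite !inE !eqSS.
by rewrite -!val_eqE /= !inordK // ltnS ltnW.
Qed.

Lemma aL_lbl1 k : (k <= N)%N -> aL iota (lbl [:: k.+1]) = wt k.
Proof. by move=> kN; rewrite lbl1 // /aL big_set1. Qed.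

Lemma aL_lbl2 k : (k < N)%N -> aL iota (lbl [:: k.+1; k.+2]) = wt k + wt k.+1.
Proof.
move=> kN; rewrite lbl2 // /aL big_setU1 ?big_set1 // inE -val_eqE /= !inordK //; lia.
Qed.

Lemma wt_neq0 k : wt k != 0.
Proof. exact: a_neq0. Qed.

Lemma s_neq0 m : (m <= N)%N -> s m.+1 != 0.
Proof.
move=> mN; rewrite -aL_upto //; apply: aL_neq0.
by apply/set0Pn; exists ord0; rewrite inE.
Qed.

Definition jacV : 'M[L]_(N.+1, N) := \matrix_(p, j) jac_v wt j p.
Definition jacW : 'M[L]_(N, N.+1) := \matrix_(i, p) jac_w wt i p.

Lemma jacWV : jacW *m jacV = 1%:M.
Proof.
apply/matrixP => i j; rewrite !mxE -val_eqE /=.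
rewrite -(jac_dual (fun k _ => wt_neq0 k) s_neq0 (ltn_ord i) (ltn_ord j)).
by apply: eq_bigr => p _; rewrite !mxE.
Qed.

Definition initial_mx m : 'M[L]_N := diag_mx (\row_i (i < m)%N%:R).

(** By [jac_resolution], the first m + 1 sites carry the m Jacobi modes of index below m. *)
Lemma Qmx_upto m : (m <= N)%N ->
  Qmx iota (upto m.+1) = s m.+1 *: (jacV *m initial_mx m *m jacW).
Proof.
move=> mN; apply/matrixP => p q; rewrite !mxE aL_upto // !inE.
have -> : s m.+1 * (p == q)%:R - polyL iota 'X_q
          = s m.+1 * ((p == q)%:R - wt q / s m.+1).
  by rewrite mulrBr mulrCA divff ?s_neq0 // mulr1 /wt inord_val.
rewrite mulrCA (jac_resolution (fun k _ => wt_neq0 k) s_neq0 p q mN); congr (_ * _).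
rewrite (big_ord_widen N (fun i => jac_v wt i p * jac_w wt i q) mN) big_mkcond.
apply: eq_bigr => i _; rewrite mul_mx_diag !mxE.
by case: (i < m)%N; rewrite ?mulr1 // mulr0 mul0r.
Qed.

Lemma Qmx_lbl1 k : (k <= N)%N -> Qmx iota (lbl [:: k.+1]) = 0.
Proof.
move=> kN; apply/matrixP => p q; rewrite !mxE aL_lbl1 // lbl1 // !inE.
case: eqP => [->|_]; last by rewrite mul0r.
case: eqP => [->|_]; last by rewrite mul0r.
by rewrite eqxx mulr1 subrr mulr0.
Qed.

(** For j = i + 1, the rank-one product of [jac_adjacent] expanded in matrix units of the modes i
    and j. *)
Definition adjacent_mx (i j : 'I_N) : 'M[L]_N :=
  (wt j * wt j.+1 / s j.+1) *:
    ((s j.+2 / wt j.+1) *: (delta_mx j j - delta_mx i j)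
     - (s j / wt j) *: (delta_mx j i - delta_mx i i)).

Lemma jac_delta (i j : 'I_N) p q :
  (jacV *m delta_mx i j *m jacW) p q = jac_v wt i p * jac_w wt j q.
Proof.
rewrite mxE (bigD1 j) //= big1 => [|k kj].
  rewrite addr0 mxE (bigD1 i) //= big1 => [|l li]; rewrite !mxE ?eqxx ?mulr1 ?addr0 //.
  by rewrite (negPf li) mulr0.
rewrite mxE big1 ?mul0r // => l _; rewrite !mxE.
by rewrite (negPf kj) andbF mulr0.
Qed.

Lemma Qmx_lbl2 (i j : 'I_N) : j = i.+1 :> nat ->
  Qmx iota (lbl [:: j.+1; j.+2]) = jacV *m adjacent_mx i j *m jacW.
Proof.
move=> ji; apply/matrixP => p q.
have subE (X Y : 'M[L]_N.+1) : (X - Y) p q = X p q - Y p q by rewrite !mxE.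
have sclE c (X : 'M[L]_N.+1) : (c *: X) p q = c * X p q by rewrite mxE.
rewrite /adjacent_mx -scalemxAr -scalemxAl sclE.
rewrite mulmxBr mulmxBl -!scalemxAr -!scalemxAl !mulmxBr !mulmxBl.
rewrite mxE aL_lbl2 // !inE !eqSS.
have -> : polyL iota 'X_q = wt q by rewrite /wt inord_val.
have iN : (i.+2 <= N)%N by rewrite -ji.
have := jac_adjacent (fun k _ => wt_neq0 k) s_neq0 p q iN.
rewrite -val_eqE !inE -!ji => ->.
rewrite !(subE, sclE) !jac_delta.
by ring.
Qed.

Definition gl_osc (M : 'M[L]_N) : A :=
  quad (mode_p (site_p iota) jacV) (mode_b (site_b iota) jacW) M.

Lemma gl_oscE M : gl_osc M = quad (site_p iota) (site_b iota) (jacV *m M *m jacW).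
Proof. exact: quad_mode. Qed.

Lemma lie_gl_osc M M' : lie (gl_osc M) (gl_osc M') = gl_osc (lie M M').
Proof. exact: lie_quad (mode_oscillators (site_oscillators iota) jacWV) _ _. Qed.

Lemma gl_osc_inj : injective gl_osc.
Proof.
move=> M M' eqM; apply/matrixP => i j.
have := congr1 (fun x => lie (mode_b (site_b iota) jacW i)
                             (lie x (mode_p (site_p iota) jacV j))) eqM.
rewrite !(quad_coef (mode_oscillators (site_oscillators iota) jacWV)).
move/eqP; rewrite -subr_eq0 -scalerBl => /eqP e0; apply/eqP; rewrite -subr_eq0.
apply: contraT => nz; have /eqP[] := UoscL_oner_neq0 iota.
by rewrite -[1]scale1r -(mulVf nz) -scalerA e0 scaler0.
Qed.

Lemma lie_diag_delta (d : 'rV[L]_N) i j :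
  lie (diag_mx d) (delta_mx i j) = (d 0 i - d 0 j) *: delta_mx i j.
Proof.
apply/matrixP => p q; rewrite /lie -!mulmxE mxE [in X in _ + X]mxE.
rewrite mul_diag_mx mul_mx_diag !mxE.
case: (p =P i) => [->|_]; case: (q =P j) => [->|_] /=;
  by rewrite ?mulr0 ?mul0r ?subr0 // mulr1 mul1r mulr1.
Qed.

Lemma lie_mxZr c (X Y : 'M[L]_N) : lie X (c *: Y) = c *: lie X Y.
Proof. by rewrite /lie -!mulmxE -scalemxAr -scalemxAl scalerBr. Qed.

Lemma lie_QL_upto_gl m M : (m <= N)%N ->
  lie (QL iota (upto m.+1)) (gl_osc M) = s m.+1 *: gl_osc (lie (initial_mx m) M).
Proof.
move=> mN; rewrite gl_oscE lie_QL_quad Qmx_upto // -(lie_quad (site_oscillators iota)).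
by rewrite quadZ -!gl_oscE lieZl lie_gl_osc.
Qed.

Definition osc_q (k : nat) : A := site_q iota (inord k).

Lemma QL_upto m : (m <= N)%N ->
  QL iota (upto m.+1) = s m.+1 *: (\sum_(k < m.+1) osc_q k + gl_osc (initial_mx m)).
Proof.
move=> mN; rewrite QL_quad Qmx_upto // quadZ -gl_oscE aL_upto // scalerDr.
congr (_ *: _ + _); rewrite -(sum_upto osc_q) //.
by apply: eq_bigr => k _; rewrite /osc_q inord_val.
Qed.

Lemma QL_lbl1 k : (k <= N)%N -> QL iota (lbl [:: k.+1]) = wt k *: osc_q k.
Proof.
by move=> kN; rewrite QL_quad Qmx_lbl1 // quad0 addr0 aL_lbl1 // lbl1 // big_set1.
Qed.

(** * Chevalley generators as images of matrix units *)

Section Adjacent.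
Variables (i j : 'I_N).
Hypothesis ji : j = i.+1 :> nat.

Let s0 : s j != 0.
Proof. by rewrite ji s_neq0 // ltnW. Qed.

Let s1 : s j.+1 != 0.
Proof. by rewrite s_neq0 // ltnW. Qed.

Let s2 : s j.+2 != 0.
Proof. exact: s_neq0. Qed.

(** The projection onto the modes below j keeps i and kills j, so its bracket has eigenvalue 1 on
    E_ij and -1 on E_ji. *)
Lemma lie_initial_up : lie (initial_mx j) (delta_mx i j) = delta_mx i j.
Proof. by rewrite lie_diag_delta !mxE ltnn ji ltnS leqnn subr0 scale1r. Qed.

Lemma lie_initial_down : lie (initial_mx j) (delta_mx j i) = - delta_mx j i.
Proof. by rewrite lie_diag_delta !mxE ltnn ji ltnS leqnn sub0r scaleN1r. Qed.

Lemma lie_initial_adjacent :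
  lie (initial_mx j) (adjacent_mx i j)
  = - ((wt j * s j.+2 / s j.+1) *: delta_mx i j)
    - (wt j.+1 * s j / s j.+1) *: (- delta_mx j i).
Proof.
rewrite /adjacent_mx lie_mxZr lieBr !lie_mxZr !lieBr lie_initial_up lie_initial_down.
rewrite !lie_diag_delta !subrr !scale0r.
have w0 := wt_neq0 j; have w1 := wt_neq0 j.+1.
by apply/matrixP => p q; rewrite !mxE; field; rewrite s1 w0 w1.
Qed.

Lemma lie_QL_adjacent :
  lie (QL iota (upto j.+1)) (QL iota (lbl [:: j.+1; j.+2]))
  = gl_osc ((wt j.+1 * s j) *: delta_mx j i - (wt j * s j.+2) *: delta_mx i j).
Proof.
rewrite lie_QL (Qmx_lbl2 ji) Qmx_upto ?(ltnW (ltn_ord j)) //.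
rewrite -(lie_quad (site_oscillators iota)) quadZ -!gl_oscE lieZl lie_gl_osc.
rewrite -quadZ lie_initial_adjacent; congr gl_osc.
by apply/matrixP => p q; rewrite !mxE; field.
Qed.

(** The bracket with Q_[j+1] has eigenvalues s_(j+1) on E_ij and - s_(j+1) on E_ji. Adding a_[j+1] =
    s_(j+1) kills the E_ji component of the inner bracket and doubles the other; [edown] does the
    opposite. The label k is the index j counted from 0, so it joins modes k - 1 and k. *)
Lemma eup_gl sqr :
  eup iota sqr j = gl_osc (- (2 * wt j * s j.+1 * s j.+2 / sqr j) *: delta_mx i j).
Proof.
rewrite /eup lie_QL_adjacent lie_QL_upto_gl ?(ltnW (ltn_ord j)) //.
rewrite aL_upto ?(leqW (ltn_ord j)) // -!quadZ -quadD -quadZ.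
rewrite lieBr !lie_mxZr lie_initial_up lie_initial_down; congr gl_osc.
apply/matrixP => p q; rewrite !mxE; ring.
Qed.

Lemma edown_gl sqr :
  edown iota sqr j = gl_osc (- (2 * wt j.+1 * s j * s j.+1 / sqr j) *: delta_mx j i).
Proof.
rewrite /edown lie_QL_adjacent lie_QL_upto_gl ?(ltnW (ltn_ord j)) //.
rewrite aL_upto ?(leqW (ltn_ord j)) // -!quadZ -quadB -quadZ.
rewrite lieBr !lie_mxZr lie_initial_up lie_initial_down; congr gl_osc.
apply/matrixP => p q; rewrite !mxE; ring.
Qed.

(** With P_m for [initial_mx m], this is (P_j - P_i) - (P_(j+1) - P_j); each difference is one
    diagonal unit because j = i + 1. *)
Lemma initial_mx_diff :
  2 *: initial_mx j - initial_mx j.+1 - initial_mx i = delta_mx i i - delta_mx j j.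
Proof.
apply/matrixP => p q; rewrite !mxE -!val_eqE /= ji.
case: (p =P q :> nat) => [<-|pq]; last first.
  rewrite /= !mulr0n mulr0 !subr0.
  have -> : ((p == i :> nat) && (q == i :> nat)) = false.
    by apply/negP => /andP[/eqP pi /eqP qi]; apply: pq; rewrite pi qi.
  have -> : ((p == i.+1 :> nat) && (q == i.+1 :> nat)) = false.
    by apply/negP => /andP[/eqP pi /eqP qi]; apply: pq; rewrite pi qi.
  by rewrite subr0.
rewrite /= !mulr1n !andbb !ltnS.
case: (ltngtP p i) => [lt|gt|e].
- have -> : (p <= i.+1)%N by lia.
  have -> : (p == i.+1 :> nat) = false by lia.
  by rewrite /= !mulr1n; ring.
- by rewrite (leq_eqVlt p) ltnS (leqNgt p) gt orbF /= !mulr0n; ring.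
- by rewrite e leqnSn ltn_eqF //= !mulr1n !mulr0n; ring.
Qed.

Lemma hdiag_gl : hdiag iota j = gl_osc (delta_mx i i - delta_mx j j).
Proof.
have jN := ltn_ord j; rewrite /hdiag.
have -> : QL iota (upto j) = s j *: (\sum_(k < j) osc_q k + gl_osc (initial_mx i)).
  by rewrite ji; apply: QL_upto; rewrite ltnW.
rewrite !aL_upto ?aL_lbl1 ?QL_lbl1 //; try lia.
rewrite !QL_upto; try lia.
rewrite !scalerA !mulVf ?wt_neq0 // divfK // !scale1r -initial_mx_diff.
rewrite /gl_osc !quadB quadZ -!/(gl_osc _) !scalerDr !big_ord_recr /=.
(* Cancellation of the q's: x is the sum of q_k over k < j, y is q_j and z is q_(j+1), while e, e',
   f come from the projections. *)
have cancel (V : zmodType) (x y z e e' f : V) :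
    x + y + (x + y) + e - (x + y + z + e') - (x + f) - y + z = e - e' - f.
  rewrite !opprD !addrA [LHS](ACl (1*6*2*7*3*10*4*12*13*8*5*9*11)) /=.
  by rewrite subrr !(add0r, subrr).
by rewrite (scaler_nat 2 (_ + _)) mulr2n cancel.
Qed.

End Adjacent.

End RacahChevalley.

(** * Membership in the Racah algebra *)

Section SubalgGen.
Variables (K : comNzRingType) (X : Type) (rel : term K X -> term K X -> Prop).

Lemma subalg_gen_lie (S : palg rel -> Prop) x y :
  subalg_gen S x -> subalg_gen S y -> subalg_gen S (lie x y).
Proof.
move=> Sx Sy; rewrite /lie addrC -scaleN1r.
by apply: subalg_lin; apply: subalg_mul.
Qed.

Lemma subalg_genZ (S : palg rel -> Prop) c x : subalg_gen S x -> subalg_gen S (c *: x).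
Proof.
have S0 : subalg_gen S 0.
  by rewrite -(addNr 1) -scaleN1r; apply: subalg_lin; exact: subalg_one.
by move=> Sx; rewrite -[c *: x]addr0; apply: subalg_lin.
Qed.

Lemma subalg_genD (S : palg rel -> Prop) x y :
  subalg_gen S x -> subalg_gen S y -> subalg_gen S (x + y).
Proof. by move=> Sx Sy; rewrite -[x]scale1r; apply: subalg_lin. Qed.

Lemma subalg_genB (S : palg rel -> Prop) x y :
  subalg_gen S x -> subalg_gen S y -> subalg_gen S (x - y).
Proof. by move=> Sx Sy; rewrite addrC -scaleN1r; apply: subalg_lin. Qed.

End SubalgGen.

Lemma chevalley_Racah (R : realType) (n : nat) (L : fieldType)
    (iota : {rmorphism {fraction {mpoly R[n]}} -> L}) (sqr : nat -> L) x :
  chevalley (iota := iota) sqr x -> Racah x.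
Proof.
case=> k /andP[k_gt0 k_le] xE.
have upto_Racah m : (0 < m)%N -> Racah (QL iota (upto n m)).
  move=> m_gt0; apply: subalg_base; exists (upto n m) => //.
  have n_gt0 : (0 < n)%N by lia.
  by apply/set0Pn; exists (Ordinal n_gt0); rewrite inE.
have lbl_Racah (l : seq nat) m : (m < n)%N -> m.+1 \in l -> Racah (QL iota (lbl n l)).
  move=> mn ml; apply: subalg_base; exists (lbl n l) => //.
  by apply/set0Pn; exists (Ordinal mn); rewrite inE.
have RQ := upto_Racah k.+1 isT.
have RQ' : Racah (QL iota (lbl n [:: k.+1; k.+2])).
  by apply: (lbl_Racah _ k); [lia | rewrite inE eqxx].
case: xE => [->|[->|->]].
- apply/subalg_genZ/subalg_genD; first by do !apply: subalg_gen_lie.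
  by apply/subalg_genZ/subalg_gen_lie.
- apply/subalg_genZ/subalg_genB; first by do !apply: subalg_gen_lie.
  by apply/subalg_genZ/subalg_gen_lie.
- apply: subalg_genD; last first.
    by apply/subalg_genZ/(lbl_Racah _ k.+1); [lia | rewrite inE].
  apply: subalg_genB; last first.
    by apply/subalg_genZ/(lbl_Racah _ k); [lia | rewrite inE].
  apply: subalg_genB; last exact/subalg_genZ/upto_Racah.
  by apply: subalg_genB; apply/subalg_genZ/upto_Racah.
Qed.

(** * Assembly of the isomorphism *)

Theorem theorem3p3 (R : realType) (n : nat) (hn : (3 <= n)%N) (L : fieldType)
    (iota : {rmorphism {fraction {mpoly R[n]}} -> L}) (sqr : nat -> L)
    (hsqr : forall k : nat, (1 <= k <= n - 2)%N ->
       sqr k ^+ 2 = radicand iota k) :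
  (forall x : UoscL iota, chevalley sqr x -> Racah x) /\
  lie_isomorphic (@lie 'M[L]_n.-1) (@lie (UoscL iota))
    (@sl L n.-1) (lie_gen (@lie (UoscL iota)) (chevalley sqr)).
Proof.
split=> [x|]; first exact: chevalley_Racah.
case: n hn iota hsqr => // N hN iota hsqr.
(* The square of [sqr j] is the radicand, a product of 4 and nonzero sums of weights. *)
have sqr_neq0 (i j : 'I_N) : j = i.+1 :> nat -> sqr j != 0.
  move=> ji; have jN := ltn_ord j; have w0 := wt_neq0 iota.
  have k_range : (1 <= j <= N.+1 - 2)%N by lia.
  rewrite -sqrf_eq0 (hsqr j k_range) /radicand ji !aL_upto ?aL_lbl1; try lia.
  by rewrite !mulf_neq0 ?expf_neq0 ?w0 ?s_neq0 ?(natrL_neq0 iota 3) //; lia.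
have gl_scale_neq0 (i j : 'I_N) c : c != 0 ->
    lie_gen (@lie (UoscL iota)) (chevalley sqr) (gl_osc iota (c *: delta_mx i j)) ->
    lie_gen (@lie (UoscL iota)) (chevalley sqr) (gl_osc iota (delta_mx i j)).
  move=> c0 Gc; rewrite -[delta_mx i j]scale1r -(mulVf c0) -scalerA.
  by rewrite /gl_osc quadZ -[_ *: _]addr0; apply: lie_lin => //; exact: lie_zero.
exists (@gl_osc R N L iota); split.
- move=> M trM.
  (* The matrices whose image lies in the generated Lie algebra form a Lie algebra. It contains the
     adjacent units, as nonzero multiples of them map to [eup] and [edown], and so it contains
     sl_N. *)
  refine (@sl_generated L N
    (fun M => lie_gen (@lie (UoscL iota)) (chevalley sqr) (gl_osc iota M)) _ _ _ _ _ M trM).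
  + by rewrite /gl_osc quad0; exact: lie_zero.
  + by move=> c x y Gx Gy; rewrite /gl_osc quad_lin; exact: lie_lin.
  + by move=> x y Gx Gy; rewrite -lie_gl_osc; exact: lie_brkt.
  + move=> i j ji; have jN := ltn_ord j.
    apply: (@gl_scale_neq0 _ _
      (- (2 * wt iota j * psum (wt iota) j.+1 * psum (wt iota) j.+2 / sqr j))).
      rewrite oppr_eq0 !mulf_neq0 ?invr_eq0 ?wt_neq0 ?s_neq0 ?(natrL_neq0 iota 1) //; try lia.
      exact: sqr_neq0 ji.
    rewrite -eup_gl //; apply: lie_base; exists (nat_of_ord j); last by left.
    by lia.
  + move=> j i ji; have jN := ltn_ord j.
    apply: (@gl_scale_neq0 _ _
      (- (2 * wt iota j.+1 * psum (wt iota) j * psum (wt iota) j.+1 / sqr j))).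
      rewrite oppr_eq0 !mulf_neq0 ?invr_eq0 ?wt_neq0 ?s_neq0 ?(natrL_neq0 iota 1) //; try lia.
        by rewrite ji s_neq0 //; lia.
      exact: sqr_neq0 ji.
    rewrite -edown_gl //; apply: lie_base; exists (nat_of_ord j); last by right; left.
    by lia.
- by move=> c x y _ _; exact: quad_lin.
- by move=> x y _ _; rewrite lie_gl_osc.
- by move=> x y _ _; exact: gl_osc_inj.
(* Surjectivity, by induction on the generation of y: the generators come from traceless matrices,
   and these are closed under the operations. *)
move=> y; elim=> {y} [y|||].
- case=> k k_range yE.
  have k_lt : (k < N)%N by lia.
  have k1_lt : (k.-1 < N)%N by lia.
  (* The label k runs from 1 to n - 2 = N - 1, so k - 1 and k are both valid modes. *)
  pose j := Ordinal k_lt; pose i := Ordinal k1_lt.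
  have ji : j = i.+1 :> nat by rewrite /=; lia.
  have ij : (i == j) = false by apply/negP => /eqP ij; move: ji; rewrite ij; lia.
  have tr_delta (p q : 'I_N) : \tr (delta_mx p q : 'M[L]_N) = (p == q)%:R.
    rewrite /mxtrace (bigD1 p) //= big1 => [|l lp]; rewrite mxE ?eqxx ?addr0 //.
    by rewrite (negPf lp).
  case: yE => [->|[->|->]].
  + rewrite -[k]/(nat_of_ord j) (eup_gl iota ji); eexists; last by [].
    by rewrite /sl mxtraceZ tr_delta ij mulr0.
  + rewrite -[k]/(nat_of_ord j) (edown_gl iota ji); eexists; last by [].
    by rewrite /sl mxtraceZ tr_delta eq_sym ij mulr0.
  + rewrite -[k]/(nat_of_ord j) (hdiag_gl iota ji); eexists; last by [].
    by rewrite /sl raddfB /= !tr_delta !eqxx subrr.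
- by exists 0; rewrite ?/sl ?mxtrace0 // /gl_osc quad0.
- move=> c x y _ [M trM <-] _ [M' trM' <-]; exists (c *: M + M'); last exact: quad_lin.
  by rewrite /sl mxtraceD mxtraceZ trM trM' mulr0 addr0.
- move=> x y _ [M _ <-] _ [M' _ <-]; exists (lie M M'); last by rewrite lie_gl_osc.
  by rewrite /sl /lie raddfB /= -!mulmxE mxtrace_mulC subrr.
Qed.
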